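(* Let $n\ge1$, let $G=\mathrm{PSL}(2,2^n)$ act on $X=\mathrm{GF}(2^n)\cup\{\infty\}$. If $B$ is a $13$-subset of $X$ with $13\mid |G_B|$, then $|G_B|=26$. Moreover, \[m_{66}=\begin{cases}1 & \text{if } n\equiv 0\pmod{6},\\ 0 & \text{if } n\not\equiv 0\pmod{6}.\end{cases}\]
   Context: $\mathrm{PSL}(2,2^n)$ is the group of all maps $X\to X$, $x\mapsto\frac{ax+b}{cx+d}$ with $a,b,c,d\in\mathrm{GF}(2^n)$, $ad-bc\neq0$ (usual conventions for $\infty$). For a $13$-subset $B$ of $X$, $G_B=\{g\in G: g(B)=B\}$ and $G(B)=\{g(B):g\in G\}$. Each orbit $G(B)$ is a simple $3$-$(2^n+1,13,\lambda_B)$ design (every $3$-subset of $X$ lies in exactly $\lambda_B$ members of $G(B)$), with $\lambda_B=1716/|G_B|$. $m_\lambda$ denotes the number of $G$-orbits $G(B)$ of $13$-subsets with $\lambda_B=\lambda$; so $m_{66}$ counts the orbits with $|G_B|=26$. *)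

(* Defs.v *)
(* MathComp *)
From HB Require Import structures.
From mathcomp Require Import all_boot all_order all_algebra all_fingroup.

Set Implicit Arguments.
Unset Strict Implicit.
Unset Printing Implicit Defensive.

Import GRing.Theory.
Local Open Scope ring_scope.

(* The projective line over F is [option F], with [None] as the point at
   infinity. When [c * x + d = 0] (or, at infinity, [c = 0]) the value is
   infinity. *)
Definition moebius (F : fieldType) (a b c d : F) (x : option F) : option F :=
  match x with
  | Some x => if c * x + d == 0 then None else Some ((a * x + b) / (c * x + d))
  | None => if c == 0 then None else Some (a / c)
  end.

(* All fractional linear maps with [a * d - b * c != 0] are allowed, so for a
   general F this is PGL(2, F); it coincides with PSL(2, F) when every element
   of F is a square, in particular when #|F| is a power of 2. *)
Definition PSL2 (F : finFieldType) : {set {perm option F}} :=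
  [set g : {perm option F} |
    [exists a : F, exists b : F, exists c : F, exists d : F,
      (a * d - b * c != 0) && [forall x, g x == moebius a b c d x]]].

Local Open Scope nat_scope.

Definition is_design (T : finType) (t v k lam : nat) (D : {set {set T}}) : bool :=
  [&& #|T| == v,
      [forall B in D, #|B| == k] &
      [forall S : {set T}, (#|S| == t) ==>
         (#|[set B in D | S \subset B]| == lam)]].

Definition block_stab (F : finFieldType) (B : {set option F}) :
    {set {perm option F}} :=
  'C_(PSL2 F)[B | 'P^*]%g.

Definition block_orbit (F : finFieldType) (B : {set option F}) :
    {set {set option F}} :=
  orbit 'P^* (PSL2 F) B.

Definition num_orbit_designs (F : finFieldType) (k lam : nat) : nat :=
  #|[set O in [set block_orbit B | B : {set option F} & #|B| == k]
      | is_design 3 #|F|.+1 k lam O]|.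

(* Main.v *)
Require Import Defs.
From mathcomp Require Import all_boot all_order all_algebra all_fingroup.
From mathcomp Require Import cyclic pgroup finfield.
From mathcomp Require Import ring.

(** The group G of fractional linear maps is sharply 3-transitive on the
    projective line X. Counting the g in G that carry a 3-set S into a block B
    in two ways gives lambda * |G_B| = |B| (|B| - 1) (|B| - 2)
    ([card_orbit_blocks]); for |B| = 13 this is 1716, so lambda = 66 means
    |G_B| = 26. The same count with B = X gives |G| = (q + 1) q (q - 1), which
    13 divides exactly when 6 divides n, because 4 has order 6 modulo 13
    ([dvd13_PSL2]).

    If 13 divides |G_B|, then B is an orbit of some g in G_B of order 13. Moving
    three consecutive points (g^-1 x, x, g x) of B to (1, oo, 0) turns g into
    x |-> b / (x + 1) for some b ([std_block_of_stab13]). The condition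
    g^13 = 1 becomes f(b) = 0 with f = X^6 + X^5 + X^2 + X + 1
    ([std_block_ord13_poly]). This normal form treats the split case 13 | q - 1
    and the nonsplit case 13 | q + 1 at once, without extending the field.

    Stabilizer. In homogeneous coordinates g multiplies the linear forms u + r v
    and u + s v by r and s, where r + s = 1 and r s = b. As r^13 = s^13, the form
    (u + r v)^13 + (u + s v)^13 is multiplied by r^13, so it vanishes on the
    whole orbit B of oo. In characteristic 2 this form is sparse, since only 8 of
    the binomials C(13, k) are odd. Comparing coefficients shows that the only
    affine maps preserving its finite zeros are x and x + 1 ([rot_form_symm]).
    Since x + 1 inverts g, it does preserve B, so the stabilizer of oo in G_B
    has order 2 and |G_B| = 13 * 2.

    Uniqueness. The translation x |-> x + b carries the block of parameter b to
    the block of parameter b^2 ([std_block_translate]). The six conjugates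
    b^(2^i) are distinct, hence are all the roots of f ([ord13_poly_roots]); so
    all blocks with 13 | |G_B| form one orbit. When 6 | n, Cauchy's theorem
    provides an element of order 13, hence such a block. *)

Set Implicit Arguments.
Unset Strict Implicit.
Unset Printing Implicit Defensive.

Import GRing.Theory.
Local Open Scope ring_scope.

(** * Homogeneous coordinates and fractional linear maps *)

(** The point with homogeneous coordinates (u : v). In these coordinates
    [moebius] is the linear action of 2 x 2 matrices, so composition and
    transitivity need no case analysis on the point at infinity. *)
Definition pt (F : fieldType) (u v : F) : option F :=
  if v == 0 then None else Some (u / v).

(** The chosen representatives are (x : 1), and (1 : 0) for infinity. *)
Definition num (F : fieldType) (x : option F) : F := odflt 1 x.
Definition den (F : fieldType) (x : option F) : F := (x != None)%:R.

Section Moebius.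
Variable F : fieldType.
Implicit Types (a b c d u v : F) (x y : option F).

Lemma ptK x : pt (num x) (den x) = x.
Proof.
by case: x => [x|]; rewrite /pt /num /den /= ?oner_eq0 ?divr1 ?eqxx.
Qed.

Lemma coord_neq0 x : (num x != 0) || (den x != 0).
Proof. by case: x => [x|]; rewrite /num /den /= ?oner_eq0 ?orbT. Qed.

Lemma bracket_neq0 x y : x != y -> num x * den y - num y * den x != 0.
Proof.
case: x y => [x|] [y|]; rewrite /num /den //= !(mulr1, mulr0, mul1r, sub0r, subr0).
- by rewrite subr_eq0.
- by rewrite oppr_eq0 oner_eq0.
- by rewrite oner_eq0.
Qed.

Lemma ptZ k u v : k != 0 -> pt (k * u) (k * v) = pt u v.
Proof.
move=> k0; rewrite /pt mulf_eq0 (negPf k0) /=.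
by case: eqP => // _; rewrite -mulf_div divff ?mul1r.
Qed.

Lemma moebius_pt a b c d u v : (u != 0) || (v != 0) ->
  moebius a b c d (pt u v) = pt (a * u + b * v) (c * u + d * v).
Proof.
rewrite {1}/pt; have [-> /=|v0 _ /=] := eqVneq v 0.
  rewrite orbF => u0; rewrite !mulr0 !addr0 /pt mulf_eq0 (negPf u0) orbF.
  by case: eqP => // _; rewrite -mulf_div divff // mulr1.
have E e h : e * (u / v) + h = v^-1 * (e * u + h * v) by field.
by rewrite !E -[RHS](@ptZ v^-1) ?invr_eq0.
Qed.

Lemma moebiusE a b c d x :
  moebius a b c d x = pt (a * num x + b * den x) (c * num x + d * den x).
Proof. by rewrite -{1}[x]ptK moebius_pt ?coord_neq0. Qed.

Lemma mul_coord_neq0 a b c d u v : a * d - b * c != 0 ->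
  (u != 0) || (v != 0) -> (a * u + b * v != 0) || (c * u + d * v != 0).
Proof.
move=> D; apply: contraLR; rewrite !negb_or !negbK => /andP[/eqP e1 /eqP e2].
have eu : (a * d - b * c) * u = d * (a * u + b * v) - b * (c * u + d * v) by ring.
have ev : (a * d - b * c) * v = a * (c * u + d * v) - c * (a * u + b * v) by ring.
move/eqP: eu; move/eqP: ev; rewrite e1 e2 !mulr0 subr0 !mulf_eq0 (negPf D) /=.
by move=> -> ->.
Qed.

Lemma moebius_comp a b c d a' b' c' d' x : a' * d' - b' * c' != 0 ->
  moebius a b c d (moebius a' b' c' d' x) =
  moebius (a * a' + b * c') (a * b' + b * d')
          (c * a' + d * c') (c * b' + d * d') x.
Proof.
move=> D; rewrite [in LHS](moebiusE a') moebius_pt ?mul_coord_neq0 ?coord_neq0 //.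
by rewrite moebiusE; congr pt; ring.
Qed.

Lemma moebius1 a x : a != 0 -> moebius a 0 0 a x = x.
Proof. by move=> a0; rewrite moebiusE !mul0r addr0 add0r ptZ ?ptK. Qed.

Lemma moebius_inj a b c d : a * d - b * c != 0 -> injective (moebius a b c d).
Proof.
move=> D; apply: (can_inj (g := moebius d (- b) (- c) a)) => x.
rewrite moebius_comp //.
have -> : d * b + - b * d = 0 by ring.
have -> : - c * a + a * c = 0 by ring.
have -> : - c * b + a * d = a * d - b * c by ring.
have -> : d * a + - b * c = a * d - b * c by ring.
exact: moebius1.
Qed.

End Moebius.

(** * Sharp 3-transitivity and the block count *)
Section PSL2.
Variable F : finFieldType.
Implicit Types (g h : {perm option F}) (x y z : option F) (B : {set option F}).
Notation G := (PSL2 F).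

Lemma PSL2P g : reflect (exists a b c d : F,
    a * d - b * c != 0 /\ g =1 moebius a b c d) (g \in PSL2 F).
Proof.
rewrite inE; apply: (iffP existsP).
  move=> [a /existsP[b /existsP[c /existsP[d /andP[D /forallP E]]]]].
  by exists a, b, c, d; split=> // x; apply/eqP.
move=> [a [b [c [d [D E]]]]]; exists a; apply/existsP; exists b.
apply/existsP; exists c; apply/existsP; exists d; rewrite D /=.
by apply/forallP=> x; rewrite E.
Qed.

Lemma moebius_PSL2 (a b c d : F) : a * d - b * c != 0 ->
  exists2 g, g \in G & g =1 moebius a b c d.
Proof.
move=> D; have E : perm (moebius_inj D) =1 moebius a b c d by apply: permE.
by exists (perm (moebius_inj D)) => //; apply/PSL2P; exists a, b, c, d.
Qed.

Lemma PSL2_group_set : group_set G.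
Proof.
apply/group_setP; split.
  apply/PSL2P; exists 1, 0, 0, 1; split; first by rewrite mul0r subr0 mul1r oner_eq0.
  by move=> x; rewrite perm1 moebius1 ?oner_eq0.
move=> g h /PSL2P[a [b [c [d [D E]]]]] /PSL2P[a' [b' [c' [d' [D' E']]]]].
apply/PSL2P; do 4!eexists; split; last first.
  by move=> x; rewrite permM E E'; apply: moebius_comp.
set X := (X in X != 0).
have -> : X = (a' * d' - b' * c') * (a * d - b * c) by rewrite /X; ring.
by rewrite mulf_neq0.
Qed.

Canonical PSL2_group := Group PSL2_group_set.

(** Writing [s t] for the determinant of the coordinates of s and t, Cramer's
    identity [x y] z = [z y] x + [x z] y says that the matrix with columns
    [z y] x and [x z] y sends (1, 0), (0, 1), (1, 1) to multiples of x, y, z. *)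
Lemma base_to_triple x y z : x != y -> x != z -> y != z ->
  exists2 g, g \in G & [/\ g None = x, g (Some 0) = y & g (Some 1) = z].
Proof.
move=> xy xz yz.
pose br s t : F := num s * den t - num t * den s.
have br0 s t : s != t -> br s t != 0 by apply: bracket_neq0.
have zy0 : br z y != 0 by rewrite br0 // eq_sym.
have D : (br z y * num x) * (br x z * den y) -
         (br x z * num y) * (br z y * den x) != 0.
  set X := (X in X != 0).
  have -> : X = br z y * (br x z * br x y) by rewrite /X /br; ring.
  by rewrite !mulf_neq0 ?zy0 ?br0.
have [g gG gE] := moebius_PSL2 D.
exists g => //; split; rewrite gE moebiusE {2 4}/num {2 4}/den /=
    !(mulr1, mulr0, addr0, add0r).
- by rewrite ptZ ?ptK.
- by rewrite ptZ ?ptK ?br0.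
rewrite -[RHS]ptK -[RHS](@ptZ _ (br x y)) ?br0 //.
by congr pt; rewrite /br; ring.
Qed.

Lemma PSL2_fix_base g : g \in G -> g None = None -> g (Some 0) = Some 0 ->
  g (Some 1) = Some 1 -> g = 1%g.
Proof.
move=> /PSL2P[a [b [c [d [D E]]]]]; rewrite !E /=.
have [c0|//] := eqVneq c 0; move: D; rewrite c0 mulr0 subr0 => D _.
move: D; rewrite mulf_eq0 negb_or => /andP[a0 d0].
rewrite !mulr0 !mul0r !add0r (negPf d0) => -[] /eqP.
rewrite mulf_eq0 invr_eq0 (negPf d0) orbF => /eqP b0.
rewrite b0 addr0 mulr1 => -[] /(congr1 (fun t => t * d)).
rewrite mul1r divfK // => ad; apply/permP=> x.
by rewrite perm1 E b0 c0 ad moebius1.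
Qed.

Lemma PSL2_eq3 g h x y z : g \in G -> h \in G -> x != y -> x != z -> y != z ->
  g x = h x -> g y = h y -> g z = h z -> g = h.
Proof.
move=> gG hG xy xz yz ex ey ez.
have [k kG [kx ky kz]] := base_to_triple xy xz yz.
have mG : (k * g * h^-1 * k^-1)%g \in G by rewrite !(groupM, groupV).
have /(canRL (mulgK _)) : (k * g * h^-1 * k^-1)%g = 1%g.
  by apply: PSL2_fix_base => //;
    rewrite !permM ?kx ?ky ?kz ?ex ?ey ?ez permK -?kx -?ky -?kz permK.
rewrite invgK mul1g => /(canRL (mulgK _)); rewrite invgK.
by move/mulgI.
Qed.

Lemma PSL2_3trans x y z x' y' z' : x != y -> x != z -> y != z ->
    x' != y' -> x' != z' -> y' != z' ->
  exists2 g, g \in G & [/\ g x = x', g y = y' & g z = z'].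
Proof.
move=> xy xz yz xy' xz' yz'.
have [k kG [<- <- <-]] := base_to_triple xy xz yz.
have [k' k'G [<- <- <-]] := base_to_triple xy' xz' yz'.
exists (k^-1 * k')%g; first by rewrite groupM ?groupV.
by rewrite !permM !permK.
Qed.

(** By sharp 3-transitivity, g is determined by its values on the three points
    [e i], and these can be any three distinct points of [B]. *)
Lemma card_PSL2_into (e : 'I_3 -> option F) B : injective e ->
  #|[set g in G | [forall i, g (e i) \in B]]| = (#|B| ^_ 3)%N.
Proof.
move=> e_inj.
have ne i j : i != j -> e i != e j by apply: contraNneq => /e_inj ->.
pose i0 : 'I_3 := inord 0; pose i1 : 'I_3 := inord 1; pose i2 : 'I_3 := inord 2.
have [n01 n02 n12] : [/\ i0 != i1, i0 != i2 & i1 != i2].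
  by split; rewrite -val_eqE /= !inordK.
have I3 (Q : 'I_3 -> Prop) : Q i0 -> Q i1 -> Q i2 -> forall i, Q i.
  move=> q0 q1 q2 i; suff: [|| i == i0, i == i1 | i == i2].
    by case/or3P=> /eqP->.
  by rewrite -!val_eqE /= !inordK //; case: i => [[|[|[|]]]].
pose t g : {ffun 'I_3 -> option F} := [ffun i => g (e i)].
rewrite -[in RHS](card_ord 3) -card_inj_ffuns_on -(card_in_imset (f := t)).
  congr #|pred_of_set _|; apply/setP=> f; rewrite [RHS]inE; apply/imsetP/andP.
    case=> g; rewrite inE => /andP[gG /forallP gB] ->; split.
      by apply/ffun_onP=> i; rewrite ffunE.
    by apply/injectiveP=> i j; rewrite !ffunE => /perm_inj/e_inj.
  case=> /ffun_onP fB /injectiveP f_inj.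
  have nf i j : i != j -> f i != f j by apply: contraNneq => /f_inj ->.
  have [g gG [g0 g1 g2]] := PSL2_3trans (ne _ _ n01) (ne _ _ n02) (ne _ _ n12)
    (nf _ _ n01) (nf _ _ n02) (nf _ _ n12).
  have gf i : g (e i) = f i by apply: (I3 (fun i => g (e i) = f i)).
  exists g; last by apply/ffunP=> i; rewrite ffunE gf.
  by rewrite inE gG /=; apply/forallP=> i; rewrite gf.
move=> g h /setIdP[gG _] /setIdP[hG _] /ffunP gh.
have {}gh i : g (e i) = h (e i) by have := gh i; rewrite !ffunE.
exact: (PSL2_eq3 gG hG (ne _ _ n01) (ne _ _ n02) (ne _ _ n12)).
Qed.

Lemma card_PSL2 : #|G| = (#|F|.+1 ^_ 3)%N.
Proof.
pose e (i : 'I_3) := nth None [:: None; Some (0 : F); Some 1] i.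
have e_inj : injective e.
  move=> i j /eqP; rewrite nth_uniq ?ltn_ord //; first by move/eqP/val_inj.
  by rewrite /= !inE !andbT /= eq_sym; apply/eqP=> -[] /eqP; rewrite oner_eq0.
rewrite -card_option -cardsT -(card_PSL2_into setT e_inj).
congr #|pred_of_set _|; apply/setP=> g; rewrite inE.
by case: (g \in G) => //=; symmetry; apply/forallP=> i; rewrite inE.
Qed.

Lemma setactE B g : 'P^*%act B g = g @: B.
Proof. by []. Qed.

Lemma block_stabP B g :
  reflect (g \in G /\ {in B, forall x, g x \in B}) (g \in block_stab B).
Proof.
rewrite /block_stab; apply: (iffP setIP) => -[gG].
  rewrite astab1_set => /astabsP gB; split=> // x xB.
  by have := gB x; rewrite /= apermE xB.
move=> gB; split=> //; apply/astab1P; rewrite setactE.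
apply/eqP; rewrite eqEcard card_imset ?leqnn ?andbT; last exact: perm_inj.
by apply/subsetP=> _ /imsetP[x xB ->]; apply: gB.
Qed.

(** Both sides count the g in G with S inside g(B). On the left they are grouped
    by the block g(B), each fibre being a coset of the stabilizer; on the right
    g is replaced by its inverse, which maps S into B. *)
Lemma card_orbit_blocks (S B : {set option F}) : #|S| = 3%N ->
  (#|[set B' in block_orbit B | S \subset B']| * #|block_stab B| = #|B| ^_ 3)%N.
Proof.
move=> S3; pose e (i : 'I_3) : option F := enum_val (cast_ord (esym S3) i).
have e_inj : injective e by move=> i j /enum_val_inj/cast_ord_inj.
have SeP (A : {set option F}) : (S \subset A) = [forall i, e i \in A].
  apply/subsetP/forallP => [SA i|eA x xS]; first by apply/SA/enum_valP.
  have := eA (cast_ord S3 (enum_rank_in xS x)).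
  by rewrite /e cast_ordK enum_rankK_in.
rewrite -(card_PSL2_into B e_inj).
pose H := [set g in G | S \subset 'P^*%act B g].
have -> : #|[set g in G | [forall i, g (e i) \in B]]| = #|H|.
  have -> : [set g in G | [forall i, g (e i) \in B]] = [set g^-1%g | g in H].
    apply/setP=> g; rewrite inE; apply/andP/imsetP.
      move=> [gG /forallP gB]; exists (g^-1)%g; last by rewrite invgK.
      rewrite inE groupV gG SeP; apply/forallP=> i; rewrite setactE.
      by apply/imsetP; exists (g (e i)); rewrite ?permK.
    move=> [h]; rewrite inE SeP => /andP[hG /forallP hB] ->.
    rewrite groupV; split=> //; apply/forallP=> i.
    by have := hB i; rewrite setactE => /imsetP[x xB ->]; rewrite permK.
  by rewrite card_imset //; apply: invg_inj.
rewrite -[RHS]sum1_card.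
rewrite (partition_big ('P^*%act B)
  (fun B' => B' \in [set B' in block_orbit B | S \subset B'])) /=; last first.
  by move=> g /setIdP[gG Sg]; rewrite inE Sg andbT mem_orbit.
rewrite -sum_nat_const; apply: eq_bigr => B'; rewrite inE => /andP[/orbitP[h hG <-] SB].
rewrite sum1_card /block_stab -(card_rcoset _ h) -amove_act ?subsetT //.
apply: eq_card => g; rewrite [RHS]unfold_in; apply/setIdP/andP.
  by case=> gG /eqP gB; split; [apply/setIdP; rewrite gB | apply/eqP].
by case=> /setIdP[].
Qed.

Lemma is_design_orbit B k lam : (2 < k)%N -> #|B| = k ->
  is_design 3 #|F|.+1 k lam (block_orbit B) = (lam * #|block_stab B| == k ^_ 3)%N.
Proof.
move=> k2 Bk.
have st0 : (0 < #|block_stab B|)%N by apply: cardG_gt0.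
rewrite /is_design card_option eqxx /=.
have -> /= : [forall (B' | B' \in block_orbit B), #|B'| == k].
  apply/forall_inP=> B' /orbitP[g gG <-]; rewrite setactE card_imset ?Bk //.
  exact: perm_inj.
apply/forallP/eqP => [des|E S].
  have /card_geqP[s [s_uniq s3 sB]] : (2 < #|B|)%N by rewrite Bk.
  have S3 : #|[set x in s]| = 3%N.
    by rewrite cardsE (card_uniqP s_uniq).
  have /implyP/(_ _)/eqP <- := des [set x in s]; last by rewrite S3.
  by rewrite card_orbit_blocks // Bk.
apply/implyP=> /eqP S3.
by rewrite -(eqn_pmul2r st0) E card_orbit_blocks // Bk.
Qed.

End PSL2.

(** * The degree 13 form and its symmetries in characteristic 2 *)

(** The form (u + r v)^13 + (u + s v)^13 with r + s = 1 and r s = b, without its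
    v^13 term r^13 + s^13 = [ord13_poly b], which is zero in the application.
    Its coefficients are the power sums r^k + s^k for k = 1, 4, 5, 8, 9, 12. The
    powers are split along 13 = 8 + 4 + 1, so that the additivity of x^4 and x^8
    can be applied to them. *)
Definition rot_form (F : fieldType) (b u v : F) : F :=
  u ^+ 8 * u ^+ 4 * v + u ^+ 8 * u * v ^+ 4
  + (1 + b + b ^+ 2) * u ^+ 8 * (v ^+ 4 * v)
  + u ^+ 4 * u * v ^+ 8 + (1 + b + b ^+ 2 + b ^+ 4) * u ^+ 4 * (v ^+ 8 * v)
  + (1 + b ^+ 4) * u * (v ^+ 8 * v ^+ 4).

(** The power sum r^13 + s^13 for r + s = 1 and r s = b, in characteristic 2. Its
    vanishing says that r / s is a 13th root of unity, or that the matrix of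
    x |-> b / (x + 1) has a scalar 13th power. *)
Definition ord13_poly (F : fieldType) (b : F) : F :=
  b ^+ 6 + b ^+ 5 + b ^+ 2 + b + 1.

Section Char2.
Variable F : fieldType.
Hypothesis char2 : 2 = 0 :> F.
Implicit Types (a b c u v x y : F).

Lemma even_vanish k : k.*2%:R = 0 :> F.
Proof. by rewrite -mul2n natrM char2 mul0r. Qed.

(** Stated as a sum equal to 0, an identity between polynomials with positive
    coefficients holds in characteristic 2 when the integer coefficients of its
    expansion are even; [even_vanish] then cancels each of them. *)
Lemma eq_of_add0 x y : x + y = 0 -> x = y.
Proof. by move=> xy; rewrite -[x]addr0 -xy; ring: char2. Qed.

Lemma sqrD2 x y : (x + y) ^+ 2 = x ^+ 2 + y ^+ 2.
Proof. by ring: char2. Qed.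

Lemma exp4D2 x y : (x + y) ^+ 4 = x ^+ 4 + y ^+ 4.
Proof. by rewrite !(exprM _ 2 2) !sqrD2. Qed.

Lemma exp8D2 x y : (x + y) ^+ 8 = x ^+ 8 + y ^+ 8.
Proof. by rewrite !(exprM _ 2 4) sqrD2 exp4D2. Qed.

Lemma sqr_inj2 : injective (fun x : F => x ^+ 2).
Proof.
move=> x y /= e; apply: eq_of_add0.
by apply/eqP; rewrite -sqrf_eq0 sqrD2 e; apply/eqP; ring: char2.
Qed.

(** The matrix of x |-> b / (x + 1) has the two linear factors as eigenvectors,
    with eigenvalues r and s; the factor b + b^5 is the common value of r^13 and
    s^13. *)
Lemma rot_form_rot b u v : ord13_poly b = 0 ->
  rot_form b (b * v) (u + v) = (b + b ^+ 5) * rot_form b u v.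
Proof.
move=> fb.
(* C is the quotient of the difference of both sides by ord13_poly b, mod 2. *)
pose C := (b ^+ 6 + b ^+ 5 + b ^+ 2 + b) * (u * v ^+ 12 + v ^+ 13)
  + (b ^+ 4 + b ^+ 2) * u ^+ 4 * v ^+ 9
  + (b ^+ 4 + b ^+ 2 + b) * u ^+ 5 * v ^+ 8
  + b ^+ 2 * u ^+ 8 * v ^+ 5 + (b ^+ 2 + b) * u ^+ 9 * v ^+ 4.
suff E : rot_form b (b * v) (u + v)
         = (b + b ^+ 5) * rot_form b u v + ord13_poly b * C.
  by rewrite E fb mul0r addr0.
apply: eq_of_add0; rewrite /C /ord13_poly /rot_form !exp4D2 !exp8D2 !exprMn.
have c4 : 4 = 0 :> F by apply: (even_vanish 2).
have c6 : 6 = 0 :> F by apply: (even_vanish 3).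
ring: char2 c4 c6.
Qed.

Lemma rot_form_homog b x v : rot_form b (x * v) v = v ^+ 13 * rot_form b x 1.
Proof. by rewrite /rot_form; ring. Qed.

(** Since x^4 and x^8 are additive, the difference has degree at most 9,
    too small for the 12 zeros that it has in [rot_form_symm]. *)
Lemma rot_form_affine b a c x :
  rot_form b (a * x + c) 1 - a ^+ 12 * rot_form b x 1 =
  (a ^+ 9 - a ^+ 12) * x ^+ 9 +
  (a ^+ 8 * (c ^+ 4 + c + (1 + b + b ^+ 2)) - a ^+ 12 * (1 + b + b ^+ 2)) * x ^+ 8
  + (a ^+ 5 - a ^+ 12) * x ^+ 5 +
  (a ^+ 4 * (c ^+ 8 + c + (1 + b + b ^+ 2 + b ^+ 4))
     - a ^+ 12 * (1 + b + b ^+ 2 + b ^+ 4)) * x ^+ 4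
  + (a * (c ^+ 8 + c ^+ 4 + (1 + b ^+ 4)) - a ^+ 12 * (1 + b ^+ 4)) * x
  + rot_form b c 1.
Proof. by rewrite /rot_form !exp4D2 !exp8D2 !exprMn; ring. Qed.

(** The polynomial of [rot_form_affine] has too many zeros, so its coefficients
    vanish: those of x^9 and x^5 give a^3 = a^7 = 1, hence a = 1, and then those
    of x^8 and x^4 give c^4 = c = c^8, hence c^2 = c. *)
Lemma rot_form_symm a b c (s : seq F) : a != 0 -> uniq s -> size s = 12%N ->
  {in s, forall x, rot_form b x 1 = 0} ->
  {in s, forall x, rot_form b (a * x + c) 1 = 0} ->
  a = 1 /\ (c = 0 \/ c = 1).
Proof.
move=> a0 s_uniq s12 P0 Pac0.
pose t5 := 1 + b + b ^+ 2; pose t9 := t5 + b ^+ 4.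
pose l := [:: rot_form b c 1;
  a * (c ^+ 8 + c ^+ 4 + (1 + b ^+ 4)) - a ^+ 12 * (1 + b ^+ 4); 0; 0;
  a ^+ 4 * (c ^+ 8 + c + t9) - a ^+ 12 * t9; a ^+ 5 - a ^+ 12; 0; 0;
  a ^+ 8 * (c ^+ 4 + c + t5) - a ^+ 12 * t5; a ^+ 9 - a ^+ 12].
have l0 : Poly l = 0.
  apply: (roots_geq_poly_eq0 (rs := s)) => //; last first.
    by rewrite s12 (leq_trans (size_Poly _)).
  apply/allP=> x xs; rewrite /root horner_Poly /=; apply/eqP.
  have := rot_form_affine b a c x; rewrite (P0 _ xs) (Pac0 _ xs) mulr0 subrr => E.
  by rewrite [RHS]E /t9 /t5; ring.
have lE i : l`_i = 0 by rewrite -coef_Poly l0 coef0.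
have a3 : a ^+ 3 = 1.
  apply: (mulfI (expf_neq0 9 a0)); rewrite mulr1 -exprD.
  by apply/esym/eqP; rewrite -subr_eq0; apply/eqP/(lE 9).
have a7 : a ^+ 7 = 1.
  apply: (mulfI (expf_neq0 5 a0)); rewrite mulr1 -exprD.
  by apply/esym/eqP; rewrite -subr_eq0; apply/eqP/(lE 5).
have a1 : a = 1 by rewrite -a7 (exprD _ 6 1) (exprM _ 3 2) a3 expr1n mul1r.
have c4 : c ^+ 4 = c.
  by apply: eq_of_add0; rewrite -(lE 8) /l /= a1 !expr1n; ring.
have c8 : c ^+ 8 = c.
  by apply: eq_of_add0; rewrite -(lE 4) /l /= a1 !expr1n; ring.
split=> //; move: c8; rewrite (exprM _ 4 2) c4 => c2.
have /eqP : c * (c - 1) = 0 by rewrite mulrBr -expr2 c2 mulr1 subrr.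
by rewrite mulf_eq0 subr_eq0 => /orP[] /eqP; [left | right].
Qed.

Lemma ord13_poly_sqr b : ord13_poly (b ^+ 2) = ord13_poly b ^+ 2.
Proof. by rewrite /ord13_poly !sqrD2 expr1n; ring. Qed.

(** A root of [ord13_poly] fixed by the k-th power of the Frobenius map would be
    a common root of f = [ord13_poly] and X^(2^k) - X. These are coprime for 0 < k < 6; the proof gives a
    Bezout relation for each k, after reducing b^8, b^16 and b^32 modulo f. *)
Lemma ord13_poly_frob_neq b k : ord13_poly b = 0 -> (0 < k < 6)%N ->
  iter k (fun x : F => x ^+ 2) b != b.
Proof.
move=> fb k6; apply/eqP => kb.
have c4 : 4 = 0 :> F by apply: (even_vanish 2).
have c6 : 6 = 0 :> F by apply: (even_vanish 3).
have b8 : b ^+ 8 = b ^+ 5 + b ^+ 4 + b ^+ 2 + 1.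
  apply: eq_of_add0; rewrite -(mul0r (b ^+ 2 + b + 1)) -fb /ord13_poly.
  by apply: eq_of_add0; ring: char2 c4 c6.
have b16 : b ^+ 16 = b ^+ 5 + b ^+ 4 + b ^+ 3 + b ^+ 2 + b.
  rewrite (exprM _ 8 2) b8 !sqrD2 expr1n; apply: eq_of_add0.
  rewrite -(mul0r (b ^+ 4 + b ^+ 3 + 1)) -fb /ord13_poly.
  by apply: eq_of_add0; ring: char2 c4 c6.
have b32 : b ^+ 32 = b ^+ 4 + b ^+ 3 + b ^+ 2.
  rewrite (exprM _ 16 2) b16 !sqrD2; apply: eq_of_add0.
  rewrite -(mul0r (b ^+ 4 + b ^+ 3)) -fb /ord13_poly.
  by apply: eq_of_add0; ring: char2 c4 c6.
(* Bezout coefficients from the extended Euclidean algorithm over GF(2). *)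
suff [u [v E]] : exists u v : F,
    1 = u * (iter k (fun x : F => x ^+ 2) b + b) + v * ord13_poly b.
  move/eqP: E; rewrite kb fb mulr0 addr0 -mulr2n -mulr_natr char2 !mulr0.
  by rewrite oner_eq0.
case: k k6 {kb} => [|[|[|[|[|[|k]]]]]] //= _; rewrite -?exprM ?b8 ?b16 ?b32.
- exists (b ^+ 4 + 1), 1.
  by apply: eq_of_add0; rewrite /ord13_poly; ring: char2 c4 c6.
- exists (b ^+ 5 + b ^+ 3 + 1), (b ^+ 3 + b ^+ 2 + 1).
  by apply: eq_of_add0; rewrite /ord13_poly; ring: char2 c4 c6.
- exists (b ^+ 3 + b ^+ 2 + 1), (b ^+ 2 + b).
  by apply: eq_of_add0; rewrite /ord13_poly; ring: char2 c4 c6.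
- exists (b ^+ 5 + b ^+ 4 + 1), (b ^+ 4 + b ^+ 3 + b ^+ 2 + b + 1).
  by apply: eq_of_add0; rewrite /ord13_poly; ring: char2 c4 c6.
exists (b ^+ 2 + 1), 1.
by apply: eq_of_add0; rewrite /ord13_poly; ring: char2 c4 c6.
Qed.

(** The six Frobenius conjugates of a root are distinct roots of a polynomial of
    degree 6, so there is no room for another root. *)
Lemma ord13_poly_roots b b' : ord13_poly b = 0 -> ord13_poly b' = 0 ->
  exists k, b' = iter k (fun x : F => x ^+ 2) b.
Proof.
move=> fb fb'; pose sq (x : F) := x ^+ 2.
have sq_iter_inj k : injective (iter k sq).
  by elim: k => // k IH x y /= /sqr_inj2/IH.
have fi k : ord13_poly (iter k sq b) = 0.
  by elim: k => //= k IH; rewrite ord13_poly_sqr IH expr0n.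
pose s := traject sq b 6.
have s_uniq : uniq s.
  apply/(uniqP b) => i j; rewrite !inE size_traject => i6 j6.
  rewrite /s !nth_traject //; wlog ij : i j i6 j6 / (i <= j)%N.
    by move=> W; case/orP: (leq_total i j) => ? => [|/esym]; first exact: W;
       move/W => ->.
  rewrite -{1}(subnK ij) addnC iterD => /sq_iter_inj => e.
  case: (posnP (j - i)) => [/eqP|ji].
    by rewrite subn_eq0 => ji; apply/eqP; rewrite eqn_leq ij.
  have := @ord13_poly_frob_neq b (j - i) fb; rewrite ji /= -/sq -e eqxx.
  by move/(_ (leq_ltn_trans (leq_subr _ _) j6)).
have [/trajectP[k _ ->]|b's] := boolP (b' \in s); first by exists k.
pose q := Poly [:: 1; 1; 1; 0; 0; 1; 1 : F].
have qE x : q.[x] = ord13_poly x by rewrite horner_Poly /= /ord13_poly; ring.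
have /(congr1 (fun r : {poly F} => r`_0)) : q = 0.
  apply: (roots_geq_poly_eq0 (rs := b' :: s)).
  - apply/allP=> x; rewrite inE /root qE => /predU1P[->|]; first by rewrite fb'.
    by case/trajectP=> k _ ->; rewrite fi.
  - by rewrite cons_uniq b's.
  by rewrite (leq_trans (size_Poly _)).
by rewrite coef_Poly coef0 /= => /eqP; rewrite oner_eq0.
Qed.

End Char2.

(** * Orbits of cyclic groups of permutations *)
Section Cycles.
Variable T : finType.
Implicit Types (g h : {perm T}) (x y : T).

Lemma mem_cycle_orbit g x i : (g ^+ i)%g x \in orbit 'P <[g]> x.
Proof. by apply/orbitP; exists (g ^+ i)%g; rewrite ?mem_cycle. Qed.

Lemma cycle_orbitP g x y :
  reflect (exists i, y = (g ^+ i)%g x) (y \in orbit 'P <[g]> x).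
Proof.
apply: (iffP idP) => [|[i ->]]; last exact: mem_cycle_orbit.
by case/orbitP=> _ /cycleP[i ->] <-; exists i.
Qed.

Lemma card_cycle_orbit g x : prime #[g]%g -> g x != x ->
  #|orbit 'P <[g]> x| = #[g]%g.
Proof.
move=> /primeP[_ p_pr] gx; move: p_pr.
move/(_ _ (dvdn_orbit 'P <[g]> x))/orP=> [] /eqP // /eqP.
rewrite (cardsD1 x) orbit_refl add1n eqSS cards_eq0 => /eqP o0.
have : g x \in orbit 'P <[g]> x :\ x.
  by rewrite !inE gx (mem_cycle_orbit g x 1).
by rewrite o0 inE.
Qed.

Lemma imset_cycle_orbit g h x :
  h @: orbit 'P <[g]> x = orbit 'P <[g ^ h]>%g (h x).
Proof.
apply/setP=> y; apply/imsetP/cycle_orbitP => [[_ /cycle_orbitP[i ->] ->]|[i ->]].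
  by exists i; rewrite -conjXg permJ.
by exists ((g ^+ i)%g x); rewrite ?mem_cycle_orbit // -conjXg permJ.
Qed.

End Cycles.

(** * Blocks stabilized by an element of order 13 *)
Section Blocks13.
Variable F : finFieldType.
Implicit Types (g h : {perm option F}) (x y : option F) (B : {set option F}).
Implicit Types (b : F).
Notation G := (PSL2 F).
Hypothesis char2 : 2 = 0 :> F.

Canonical block_stab_group B := [group of block_stab B].

(** The normal form of a 13-block with a symmetry of order 13: the orbit of
    infinity under x |-> b / (x + 1), which maps 1 to infinity to 0. *)
Definition std_block (b : F) B :=
  exists2 g : {perm option F}, g =1 moebius 0 b 1 1 &
    #[g]%g = 13%N /\ B = orbit 'P <[g]> None.

Lemma std_block_inj b B B' : std_block b B -> std_block b B' -> B = B'.
Proof.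
case=> g gE [_ ->] [g' g'E [_ ->]].
by have -> : g = g' by apply/permP=> x; rewrite gE g'E.
Qed.

Lemma block_orbit_eq B h : h \in G -> block_orbit (h @: B) = block_orbit B.
Proof. exact: (orbit_act ('P^*)%act). Qed.

Lemma card_block_stab_act B h : h \in G ->
  #|block_stab (h @: B)| = #|block_stab B|.
Proof.
move=> hG; have := card_orbit_stab ('P^*)%act (PSL2_group F) B.
rewrite -(card_orbit_stab ('P^*)%act (PSL2_group F) (h @: B)).
have -> : orbit 'P^* (PSL2_group F) (h @: B) = orbit 'P^* (PSL2_group F) B.
  exact: block_orbit_eq.
move/eqP; rewrite eqn_pmul2l; first by move/eqP.
by apply/card_gt0P; exists B; apply: orbit_refl.
Qed.

(** A fractional linear map with 1 |-> oo |-> 0 is x |-> b / (x + 1), so it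
    suffices to move (g^-1 x, x, g x) to (1, oo, 0). *)
Lemma order13_to_std g x : g \in G -> #[g]%g = 13%N -> g x != x ->
  exists2 h, h \in G & exists b, std_block b (h @: orbit 'P <[g]> x).
Proof.
move=> gG g13 gx.
have gVx : (g^-1)%g x != x by apply: contraNneq gx => e; rewrite -{1}e permKV.
have ggx : (g^-1)%g x != g x.
  apply: contra gx => /eqP e.
  (* If g^2 fixes x, then so does g = g^14 = (g^2)^7. *)
  have g2 : (g ^+ 2)%g x = x by rewrite expgS expg1 permM -e permKV.
  have g2n n : ((g ^+ 2) ^+ n)%g x = x.
    by elim: n => [|n IH]; rewrite ?perm1 // expgS permM g2.
  have g131 : (g ^+ 13)%g = 1%g by rewrite -g13 expg_order.
  by apply/eqP; rewrite -[RHS](g2n 7%N) -expgM (expgD g 13 1) g131 mul1g expg1.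
have xgx : x != g x by rewrite eq_sym.
have n10 : Some (1 : F) != Some 0.
  by apply/eqP=> -[] /eqP; rewrite oner_eq0.
have [h hG [h1 h2 h3]] := PSL2_3trans gVx ggx xgx (isT : Some 1 != None) n10
  (isT : None != Some 0).
exists h => //.
have g'G : (g ^ h)%g \in G by rewrite groupJ.
have e1 : (g ^ h)%g (Some 1) = None by rewrite -h1 permJ permKV.
have e2 : (g ^ h)%g None = Some 0 by rewrite -h2 permJ.
have /PSL2P[a [b [c [d [D E]]]]] := g'G.
move: e1 e2; rewrite !E /= !mulr1.
have [//|c0] := eqVneq c 0; have [cd _|//] := eqVneq (c + d) 0.
case=> /eqP; rewrite mulf_eq0 invr_eq0 (negPf c0) orbF => /eqP a0.
have {cd}dc : d = c by apply/esym/(eq_of_add0 char2).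
exists (b / c); exists (g ^ h)%g; last first.
  by rewrite orderJ g13 imset_cycle_orbit h2.
move=> y; rewrite E a0 dc !moebiusE -[RHS](@ptZ _ c) //.
by congr pt; field.
Qed.

Lemma std_block_param b B : std_block b B ->
  b != 0 /\ exists2 g : {perm option F}, g \in G /\ g =1 moebius 0 b 1 1 &
    #[g]%g = 13%N /\ B = orbit 'P <[g]> None.
Proof.
case=> g gE [g13 BE].
have b0 : b != 0.
  apply/eqP=> b0; have : g None = g (Some 0).
    by rewrite !gE !moebiusE b0 /num /den /=; congr pt; ring.
  by move/perm_inj.
split=> //; exists g => //; split=> //; apply/PSL2P; exists 0, b, 1, 1.
by split=> //; rewrite mul0r mulr1 sub0r oppr_eq0.
Qed.

(** The linear map on coordinates that induces x |-> b / (x + 1). *)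
Definition rot_vec (b : F) (w : F * F) := (b * w.2, w.1 + w.2).

Lemma rot_iter b g i : b != 0 -> g =1 moebius 0 b 1 1 ->
  let w := iter i (rot_vec b) (1, 0) in
  ((w.1 != 0) || (w.2 != 0)) /\ (g ^+ i)%g None = pt w.1 w.2.
Proof.
move=> b0 gE; elim: i => [|i [IH1 IH2]] /=.
  by rewrite oner_eq0 perm1 /pt eqxx.
set w := iter i _ _ in IH1 IH2 *.
have D : 0 * 1 - b * 1 != 0 by rewrite mul0r mulr1 sub0r oppr_eq0.
have := mul_coord_neq0 D IH1; rewrite expgSr permM IH2 gE moebius_pt //.
by rewrite mul0r add0r !mul1r.
Qed.

(** The 13th iterate of (1, 0) must again represent infinity, so its second
    coordinate vanishes. That coordinate is a Fibonacci polynomial in b, whose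
    reduction modulo 2 is [ord13_poly]. *)
Lemma std_block_ord13_poly b B : std_block b B -> ord13_poly b = 0.
Proof.
case/std_block_param=> b0 [g [gG gE] [g13 _]].
have [_] := rot_iter 13 b0 gE.
rewrite -{1}g13 expg_order perm1 /pt; case: eqP => // w0 _.
have E : (iter 13 (rot_vec b) (1, 0)).2 = ord13_poly b + 2 * (5 * b
    + 22 * b ^+ 2 + 42 * b ^+ 3 + 35 * b ^+ 4 + 10 * b ^+ 5).
  by rewrite /= /ord13_poly; ring.
by move: w0; rewrite E char2 mul0r addr0.
Qed.

(** The form vanishes at infinity because it has no u^13 term, and [rot_form_rot]
    carries the zero along the orbit. *)
Lemma std_block_root b B (x : F) : std_block b B ->
  Some x \in B -> rot_form b x 1 = 0.
Proof.
move=> BE; have fb := std_block_ord13_poly BE.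
case/std_block_param: BE => b0 [g [gG gE] [g13 ->]] /cycle_orbitP[i].
have [] := rot_iter i b0 gE; set w := iter i _ _ => _ ->.
have : rot_form b w.1 w.2 = 0.
  rewrite /w; elim: i {w} => [|i IH] /=; first by rewrite /rot_form; ring.
  by rewrite rot_form_rot // IH mulr0.
rewrite /pt; have [//|w0 wf] := eqVneq w.2 0; case=> xE.
have := rot_form_homog b x w.2; rewrite xE divfK // wf => /esym/eqP.
by rewrite mulf_eq0 expf_eq0 (negPf w0) /= => /eqP.
Qed.

Lemma card_std_block b B : std_block b B -> #|B| = 13%N.
Proof. by case=> g gE [g13 ->]; rewrite card_cycle_orbit ?g13 // gE /= oner_eq0. Qed.

Lemma std_block_None b B : std_block b B -> None \in B.
Proof. by case=> g gE [g13 ->]; apply: orbit_refl. Qed.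

(** If g is x |-> b / (x + 1), then g^2 conjugated by the translation x |-> x + b
    is x |-> b^2 / (x + 1), and g^2 generates the same group as g. *)
Lemma std_block_translate b B : std_block b B ->
  exists2 h, h \in G & std_block (b ^+ 2) (h @: B).
Proof.
case/std_block_param=> b0 [g [gG gE] [g13 ->]].
have D : 1 * 1 - b * 0 != 0 by rewrite mulr0 subr0 mulr1 oner_eq0.
have Dg : 0 * 1 - b * 1 != 0 by rewrite mul0r mulr1 sub0r oppr_eq0.
have [h hG hE] := moebius_PSL2 D; exists h => //.
have gg : <[g]>%g = <[g ^+ 2]>%g.
  by apply/eqP; rewrite -/(generator _ _) generator_coprime g13.
exists ((g ^+ 2) ^ h)%g.
  move=> x; rewrite -[x](permKV h); set y := (h^-1)%g x.
  rewrite permJ expgS expg1 permM !gE !hE !moebius_comp //.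
  by congr (moebius _ _ _ _ y); ring: char2.
split; first by rewrite orderJ /order -gg.
by rewrite gg imset_cycle_orbit hE /= eqxx.
Qed.

(** With t : x |-> x + 1, g t g = t, so that t inverts g; as t fixes infinity, it
    maps g^i(oo) to g^-i(oo). *)
Lemma std_block_reflection b B : std_block b B ->
  exists2 t, t \in block_stab B & t =1 moebius 1 1 0 1.
Proof.
case/std_block_param=> b0 [g [gG gE] [g13 ->]].
have D : 1 * 1 - 1 * 0 != 0 :> F by rewrite mulr0 subr0 mulr1 oner_eq0.
have Dg : 0 * 1 - b * 1 != 0 by rewrite mul0r mulr1 sub0r oppr_eq0.
have [t tG tE] := moebius_PSL2 D; exists t => //.
have gtg x : g (t (g x)) = t x.
  rewrite !gE !tE (@moebius_comp _ _ _ _ _ 0) // moebius_comp.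
    rewrite !moebiusE -[RHS](@ptZ _ b) //.
    by congr pt; ring: char2.
  by rewrite (_ : _ - _ = - b) ?oppr_eq0 //; ring.
have gt : (g ^ t)%g = (g^-1)%g.
  by apply/permP=> x; rewrite -[x](permKV t) permJ -[in RHS]gtg permK.
apply/block_stabP; split=> // _ /cycle_orbitP[i ->].
have tN : t None = None by rewrite tE /= eqxx.
apply/cycle_orbitP; exists (12 * i)%N; rewrite -permJ tN conjXg gt expgM.
congr ((fun_of_perm (_ ^+ i)%g) _).
by apply/(mulgI g); rewrite mulgV -expgS -g13 expg_order.
Qed.

Lemma stab_None_affine g : g \in G -> g None = None ->
  exists a c : F, a != 0 /\ forall x : F, g (Some x) = Some (a * x + c).
Proof.
move=> /PSL2P[a [b [c [d [D E]]]]]; rewrite E /=.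
have [c0 _|//] := eqVneq c 0; move: D; rewrite c0 mulr0 subr0.
rewrite mulf_eq0 negb_or => /andP[a0 d0].
exists (a / d), (b / d); split=> [|x]; first by rewrite mulf_neq0 ?invr_eq0.
rewrite E c0 /= mul0r add0r (negPf d0); congr Some; by field.
Qed.

(** A symmetry of B fixing infinity is affine and permutes the 12 finite points
    of B, all of which are zeros of the form; [rot_form_symm] leaves x and
    x + 1. *)
Lemma std_block_point_stab b B : std_block b B ->
  #|'C_(block_stab B)[None | 'P]%g| = 2%N.
Proof.
move=> BE; have [t tB tE] := std_block_reflection BE.
have t1 : t != 1%g.
  apply: contra_eq_neq (tE (Some 0)) => ->; rewrite perm1 /= !mul0r !add0r oner_eq0.
  by apply/eqP=> -[] /esym/eqP; rewrite mulr0 add0r divr1 oner_eq0.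
suff -> : 'C_(block_stab B)[None | 'P]%g = [set 1%g; t] by rewrite cards2 eq_sym t1.
apply/setP=> g; rewrite in_set2; apply/idP/idP; last first.
  case/orP=> /eqP->; first by rewrite group1.
  by apply/setIP; split=> //; apply/astab1P; rewrite /= apermE tE /= eqxx.
case/setIP=> gB /astab1P; rewrite /= apermE => gN.
case/block_stabP: gB => gG gB.
have [a [c [a0 gE]]] := stab_None_affine gG gN.
pose X := [set x : F | Some x \in B].
have BX : B = None |: Some @: X.
  apply/setP=> -[x|]; rewrite !inE ?(std_block_None BE) //=.
  by rewrite mem_imset ?inE //; apply: Some_inj.
have X12 : size (enum X) = 12%N.
  rewrite -cardE; apply/eqP; rewrite -eqSS -(card_std_block BE) BX cardsU1.
  rewrite card_imset; last exact: Some_inj.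
  by rewrite (_ : None \in _ = false) //; apply/imsetP=> -[].
have [||a1 c01] := rot_form_symm char2 (b := b) a0 (enum_uniq X) X12 (c := c).
- by move=> x; rewrite mem_enum inE; apply: std_block_root BE.
- move=> x; rewrite mem_enum inE => xB; apply: std_block_root BE _.
  by rewrite -gE gB.
have tS (x : F) : t (Some x) = Some (1 * x + 1).
  by rewrite tE /= mul0r add0r oner_eq0 divr1.
case: c01 => c01; apply/orP; [left | right]; apply/eqP/permP=> -[x|].
- by rewrite gE perm1 a1 c01 mul1r addr0.
- by rewrite gN perm1.
- by rewrite gE tS a1 c01.
- by rewrite gN tE /= eqxx.
Qed.

Lemma std_block_stab b B : std_block b B -> #|block_stab B| = 26%N.
Proof.
move=> BE; rewrite -(card_orbit_stab 'P%act (block_stab_group B) None).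
have -> : #|'C_(block_stab_group B)[None | 'P]%g| = 2%N.
  exact: std_block_point_stab BE.
suff -> : orbit 'P (block_stab_group B) None = B by rewrite (card_std_block BE).
apply/setP=> x; apply/idP/idP.
  case/orbitP=> g /block_stabP[_ gB] <-; apply: gB; exact: std_block_None BE.
case/std_block_param: BE => b0 [g [gG gE] [g13 BE]].
rewrite {1}BE => /cycle_orbitP[i ->]; apply/orbitP; exists (g ^+ i)%g => //.
apply/block_stabP; split; first by rewrite (@groupX _ (PSL2_group F)).
by rewrite BE => _ /cycle_orbitP[j ->]; rewrite -permM -expgD mem_cycle_orbit.
Qed.

(** The two parameters are roots of [ord13_poly], so b' = b^(2^k) for some k, and k
    translations lead from B to the standard block of parameter b', which is
    B'. *)
Lemma std_block_unique b b' B B' : std_block b B -> std_block b' B' ->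
  block_orbit B' = block_orbit B.
Proof.
move=> BE BE'.
have [k b'E] := ord13_poly_roots char2 (std_block_ord13_poly BE)
  (std_block_ord13_poly BE').
have [h hG hE] : exists2 h, h \in G & std_block b' (h @: B).
  rewrite {}b'E; elim: k => [|k [h hG hB]].
    exists 1%g; first exact: group1.
    by rewrite (_ : _ @: B = B) //; under eq_imset do rewrite perm1; apply: imset_id.
  have [h' h'G h'B] := std_block_translate hB; exists (h * h')%g; first by rewrite groupM.
  rewrite (_ : _ @: B = h' @: (h @: B)) // -imset_comp.
  by apply: eq_imset => x; rewrite /= permM.
by rewrite (std_block_inj BE' hE) block_orbit_eq.
Qed.

(** An element g of order 13 in the stabilizer moves some point x of B, because
    only the identity fixes three points; the g-orbit of x then has 13 points and
    fills B. *)
Lemma std_block_of_stab13 B : #|B| = 13%N -> (13 %| #|block_stab B|)%N ->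
  exists2 h, h \in G & exists b, std_block b (h @: B).
Proof.
move=> B13 /(Cauchy (isT : prime 13))[g /block_stabP[gG gB] g13].
have [x xB gx] : exists2 x, x \in B & g x != x.
  apply/exists_inP; apply: contraT; rewrite negb_exists_in => /forall_inP fixB.
  have fB x : x \in B -> g x = x by move/fixB; rewrite negbK => /eqP.
  have /card_gt2P[x [y [z [[xB yB zB] [xy yz zx]]]]] : (2 < #|B|)%N by rewrite B13.
  have g1 : g = 1%g.
    apply: (PSL2_eq3 gG (group1 _) xy _ yz); rewrite ?perm1 ?fB //.
    by rewrite eq_sym.
  by move: g13; rewrite g1 order1.
have -> : B = orbit 'P <[g]> x.
  apply/esym/eqP; rewrite eqEcard card_cycle_orbit ?g13 ?B13 // leqnn andbT.
  apply/subsetP=> _ /cycle_orbitP[i ->]; elim: i => [|i IH]; first by rewrite perm1.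
  by rewrite expgSr permM gB.
exact: order13_to_std.
Qed.

Lemma std_block_exists : (13 %| #|G|)%N -> exists b B, std_block b B.
Proof.
move/(Cauchy (isT : prime 13))=> [g gG g13].
have [x gx] : exists x, g x != x.
  apply/existsP; apply: contraT; rewrite negb_exists => /forallP fixg.
  suff g1 : g = 1%g by move: g13; rewrite g1 order1.
  by apply/permP=> x; have := fixg x; rewrite negbK perm1 => /eqP.
by have [h hG [b hb]] := order13_to_std gG g13 gx; exists b; eexists; exact: hb.
Qed.

End Blocks13.

(** * Conclusion *)

(** 13 does not divide q = 2^n, so it divides (q + 1) q (q - 1) exactly when it
    divides q^2 - 1 = 4^n - 1, and 4 has order 6 modulo 13. *)
Lemma dvd13_PSL2 (n : nat) (F : finFieldType) : #|F| = (2 ^ n)%N ->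
  (13 %| #|PSL2 F|)%N = (n %% 6 == 0)%N.
Proof.
move=> Fn; rewrite card_PSL2 Fn !ffactnS ffactn0 muln1 /= mulnCA.
rewrite Euclid_dvdM // Euclid_dvdX // andFb orFb.
have -> : ((2 ^ n).+1 * (2 ^ n).-1 = 4 ^ n - 1)%N.
  by rewrite -subn1 -addn1 mulnC -(subn_sqr _ 1) exp1n -expnM mulnC expnM.
rewrite -eqn_mod_dvd ?expn_gt0 // {1}(divn_eq n 6) expnD mulnC (mulnC _ 6) expnM.
have period k : ((4 ^ 6) ^ k = 1 %[mod 13])%N by rewrite -modnXm exp1n.
rewrite -modnMmr period modnMmr muln1.
by case: (n %% 6)%N (ltn_pmod n (isT : 0 < 6)%N) => [|[|[|[|[|[|m]]]]]].
Qed.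

Local Open Scope nat_scope.

Theorem proposition3p5 (n : nat) (F : finFieldType)
    (hn : 1 <= n) (hF : #|F| = 2 ^ n) :
  (forall B : {set option F},
      #|B| = 13 -> 13 %| #|block_stab B| -> #|block_stab B| = 26) /\
  num_orbit_designs F 13 66 = if n == 0 %[mod 6] then 1 else 0.
Proof.
have char2 : (2 = 0 :> F)%R.
  exact: pcharf0 (card_finPcharP hF isT).
have stab26 (B : {set option F}) :
    #|B| = 13 -> 13 %| #|block_stab B| -> #|block_stab B| = 26.
  move=> B13 /(std_block_of_stab13 char2 B13)[h hG [b hB]].
  by rewrite -(card_block_stab_act B hG) (std_block_stab char2 hB).
split=> //.
have des (B : {set option F}) : #|B| = 13 ->
    is_design 3 #|F|.+1 13 66 (block_orbit B) = (#|block_stab B| == 26).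
  by move=> B13; rewrite is_design_orbit // -[RHS](eqn_pmul2l (isT : 0 < 66)).
rewrite mod0n -(dvd13_PSL2 hF) /num_orbit_designs; case: ifP => n6.
  have [b [B BE]] := std_block_exists char2 n6.
  apply/eqP/cards1P; exists (block_orbit B); apply/setP=> O; rewrite in_set1.
  apply/setIdP/eqP => [[/imsetP[B' B'13 ->]]|->].
    rewrite inE in B'13; move/eqP: B'13 => B'13; rewrite des // => /eqP B'26.
    have [|h hG [b' hB']] := std_block_of_stab13 char2 B'13; first by rewrite B'26.
    by rewrite -(block_orbit_eq B' hG) (std_block_unique char2 BE hB').
  have B13 := card_std_block BE.
  rewrite des // (std_block_stab char2 BE) eqxx; split=> //.
  by apply/imsetP; exists B; rewrite ?inE ?B13.
apply/eqP; rewrite cards_eq0; apply/eqP/setP=> O; rewrite in_set0.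
apply/negP=> /setIdP[/imsetP[B B13 ->]]; rewrite inE in B13.
rewrite des ?(eqP B13) // => /eqP B26; move/negP: n6; apply.
by apply: (@dvdn_trans 26) => //; rewrite -B26 cardSg // subsetIl.
Qed.
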